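(* Let $G$ be a finite connected graph and $H$ a subgraph with $|V^H|\ge2$. Suppose that $H^c:=V^G\setminus V^H$ is an independent set and that every vertex of $H$ has exactly one neighbor in $H^c$. Then $$\varphi_{\mathrm{Kron}}^{H,G}\le\varphi_0^{H,G}\le 2\,\varphi_{\mathrm{Kron}}^{H,G}.$$
   Context: $G=(V^G,E^G)$ is simple and unweighted, $H=(V^H,E^H)$. View graphs as $1$-dimensional simplicial complexes with oriented edges; $C_0,C_1$ are real chains with the inner product for which simplices are orthonormal. Let $B$ and $D$ be the submatrices of the incidence matrix of $G$ (matrix of $\partial_1^G:C_1^G\to C_0^G$) with rows indexed by $V^H$ and by $V^G\setminus V^H$. Let $C_1^{G,H}=\{c\in C_1^G:\partial_1^Gc\in C_0^H\}=\ker D$, and let $P:C_1^G\to C_1^G$ be the orthogonal projection onto $C_1^{G,H}$. The persistent Laplacian is $\Delta_0^{H,G}=\partial_1^{G,H}(\partial_1^{G,H})^*=BPB^T$ on $C_0^H=\mathbb{R}^{V^H}$, where $\partial_1^{G,H}:C_1^{G,H}\to C_0^H$ is the restriction of $\partial_1^G$. For $A\subseteq V^H$, $\chi_A\in\mathbb{R}^{V^H}$ is its indicator vector. Define $$\varphi_{\mathrm{Kron}}^{H,G}=\min_{\substack{\varnothing\ne H_1\subseteq V^H\\ |H_1|\le|V^H|/2}}\frac{\chi_{H_1}^T\Delta_0^{H,G}\chi_{H_1}}{|H_1|},\qquad \varphi_0^{H,G}=\min_{\substack{0\ne x\in\mathbb{R}^{V^H}\\ x\perp^1\ker(PB^T)}}\frac{\|PB^Tx\|_1}{\|x\|_1},$$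 where $x\perp^1Y$ means $\|x+y\|_1\ge\|x\|_1$ for all $y\in Y$. *)

(* Defs.v *)
From HB Require Import structures.
From mathcomp Require Import all_boot all_order all_algebra.
From mathcomp Require Import boolp classical_sets reals.
Set Implicit Arguments.
Unset Strict Implicit.
Unset Printing Implicit Defensive.
Import Order.TTheory GRing.Theory Num.Theory.
Local Open Scope ring_scope.

Record sgraph (T : finType) := SGraph {
  adj :> rel T;
  adj_sym : symmetric adj;
  adj_irr : irreflexive adj }.

Record subgraph (T : finType) (G : sgraph T) := SubGraph {
  sub_verts : {set T};
  sub_adj : rel T;
  sub_adj_sym : symmetric sub_adj;
  sub_adjP : forall u v, sub_adj u v ->
    [/\ u \in sub_verts, v \in sub_verts & G u v] }.

Definition connected_graph (T : finType) (G : sgraph T) : Prop :=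
  forall u v : T, connect G u v.

Definition independent (T : finType) (G : sgraph T) (A : {set T}) : Prop :=
  forall u v, u \in A -> v \in A -> ~~ G u v.

(* (u, v) \in E is the edge {u, v} oriented from u to v; each edge of G
   receives exactly one of its two orientations. *)
Definition orientation (T : finType) (G : sgraph T) (E : {set T * T}) : Prop :=
  (forall u v, (u, v) \in E -> G u v) /\
  (forall u v, G u v -> ((u, v) \in E) (+) ((v, u) \in E)).

Section Projection.
Variables (R : realType) (p n : nat).

(* mxalgebra acts on row vectors: kermx M^T spans the (transposed) c with
   M c = 0, so orthoc below is the orthogonal complement of a row space, and
   the outer transpose makes proj_ker act on columns. *)
Definition orthoc (m : nat) (W : 'M[R]_(m, n)) : 'M[R]_n := kermx W^T.

Definition proj_ker (D : 'M[R]_(p, n)) : 'M[R]_n :=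
  let W := kermx D^T in (proj_mx W (orthoc W))^T.

Lemma orthoc_cap (W : 'M[R]_n) : (W :&: orthoc W = 0)%MS.
Proof.
apply/eqP/rowV0P => v; rewrite sub_capmx => /andP[/submxP[a ->] /sub_kermxP vW].
have vv0 : (a *m W) *m (a *m W)^T = 0 by rewrite trmx_mul mulmxA vW mul0mx.
apply/rowP => j; rewrite [RHS]mxE; apply/eqP; rewrite -sqrf_eq0.
move/matrixP: vv0 => /(_ 0 0); rewrite [LHS]mxE [RHS]mxE => /eqP.
rewrite (eq_bigr (fun k => (a *m W) 0 k ^+ 2)); last first.
  by move=> k _; rewrite [X in _ * X]mxE expr2.
rewrite psumr_eq0 => [/allP/(_ j)|k _]; last exact: sqr_ge0.
by rewrite mem_index_enum => /(_ isT).
Qed.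

Lemma orthoc_add (W : 'M[R]_n) : (W + orthoc W :=: 1%:M)%MS.
Proof.
apply/eqmxP; rewrite submx1 sub1mx /row_full; apply/eqP.
move: (mxrank_sum_cap W (orthoc W)).
by rewrite orthoc_cap mxrank0 addn0 mxrank_ker mxrank_tr subnKC ?rank_leq_row.
Qed.

(* proj_ker D is the orthogonal projection onto ker D. *)
Lemma proj_kerP (D : 'M[R]_(p, n)) (c : 'cV[R]_n) :
  D *m (proj_ker D *m c) = 0 /\
  forall z : 'cV[R]_n, D *m z = 0 -> (c - proj_ker D *m c)^T *m z = 0.
Proof.
rewrite /proj_ker; set W := kermx D^T; set Q := proj_mx _ _.
have WD (u : 'rV_n) : (u <= W)%MS -> D *m u^T = 0.
  by move=> /sub_kermxP uD; rewrite -[D]trmxK -trmx_mul uD trmx0.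
have -> : Q^T *m c = (c^T *m Q)^T by rewrite [RHS]trmx_mul trmxK.
split=> [|z Dz]; first exact/WD/proj_mx_sub.
have: (c^T - c^T *m Q <= orthoc W)%MS.
  by apply: proj_mx_compl_sub; rewrite orthoc_add submx1.
move/sub_kermxP => h.
rewrite (_ : (c - _)^T = c^T - c^T *m Q); last by rewrite raddfB /= trmxK.
have /submxP[a za] : (z^T <= W)%MS.
  by apply/sub_kermxP; rewrite -trmx_mul Dz trmx0.
by rewrite -[z]trmxK za trmx_mul mulmxA h mul0mx.
Qed.

End Projection.

Section PersistentLaplacian.
Variables (R : realType) (T : finType) (VH : {set T}) (E : {set T * T}).

Definition incidence (x : T) (uv : T * T) : R :=
  (x == uv.2)%:R - (x == uv.1)%:R.

(* Rows and columns are indexed through the canonical enumerations of VH,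
   of its complement, and of E. *)
Definition Bmx : 'M[R]_(#|VH|, #|E|) :=
  \matrix_(i, j) incidence (enum_val i) (enum_val j).

Definition Dmx : 'M[R]_(#|~: VH|, #|E|) :=
  \matrix_(i, j) incidence (enum_val i) (enum_val j).

Definition Pmx : 'M[R]_#|E| := proj_ker Dmx.

Definition persistent_laplacian : 'M[R]_#|VH| := Bmx *m Pmx *m Bmx^T.

Definition chi (A : {set T}) : 'cV[R]_#|VH| :=
  \col_i (enum_val i \in A)%:R.

Definition l1norm (n : nat) (x : 'cV[R]_n) : R := \sum_i `|x i 0|.

Definition l1_orthogonal (n : nat) (x : 'cV[R]_n) (Y : set 'cV[R]_n) : Prop :=
  forall y, Y y -> l1norm x <= l1norm (x + y).

Definition ker_PBT : set 'cV[R]_#|VH| :=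
  fun y => Pmx *m Bmx^T *m y = 0.

Definition kron_quotients : set R := fun q =>
  exists H1 : {set T},
    [/\ H1 != finset.set0, H1 \subset VH, #|H1|%:R <= #|VH|%:R / 2 :> R &
        q = ((chi H1)^T *m persistent_laplacian *m chi H1) 0 0 / #|H1|%:R].

Definition l1_quotients : set R := fun q =>
  exists x : 'cV[R]_#|VH|,
    [/\ x != 0, l1_orthogonal x ker_PBT &
        q = l1norm (Pmx *m Bmx^T *m x) / l1norm x].

Definition is_min (A : set R) (m : R) : Prop := A m /\ lbound A m.

Definition is_phi_Kron (phi : R) : Prop := is_min kron_quotients phi.

Definition is_phi_0 (phi : R) : Prop := is_min l1_quotients phi.

End PersistentLaplacian.

(* Main.v *)
(* PB^T x is the gradient of the extension of x to V^G whose value at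
   w outside V^H is the mean of x over the neighbours of w: this gradient
   differs from B^T x by a combination of rows of D, and it lies in ker D
   because H^c is independent.  Summing over stars,
   x^T Delta x is therefore, for x with values in {0, 1}, the cut weight
   sum_{u,v} W(u,v) |x_u - x_v| / 2 of the Kron-reduced graph, where W adds
   1 / deg w to the edges of G for every pair of neighbours of w, and
     x^T Delta x <= ||PB^T x||_1 <= 2 x^T Delta x.
   The indicator of H_1 with |H_1| <= |V^H| / 2 is orthogonal in the l1 sense
   to ker(PB^T), which consists of the constants, so the right inequality gives
   phi_0 <= 2 phi_Kron.  For arbitrary x the cut weight is still at most
   ||PB^T x||_1, and orthogonality to constants says that 0 is a median of x:
   the level sets of the positive and negative parts of x have at most |V^H| / 2
   elements, and a discrete coarea argument gives
   phi_Kron ||x||_1 <= ||PB^T x||_1. *)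
Require Import Defs.
From mathcomp Require Import all_boot all_order all_algebra.
From mathcomp Require Import boolp classical_sets reals.
From mathcomp Require Import ring lra.
From mathcomp Require Import topology normedtype derive.
Set Implicit Arguments.
Unset Strict Implicit.
Unset Printing Implicit Defensive.
Import Order.TTheory GRing.Theory Num.Theory.
Import numFieldNormedType.Exports.
Local Open Scope ring_scope.

(** * Attainment of the minimal l1 quotient *)

Lemma l1norm_ge0 (R : realType) n (x : 'cV[R]_n) : 0 <= l1norm x.
Proof. exact: sumr_ge0. Qed.

Lemma l1norm_eq0 (R : realType) n (x : 'cV[R]_n) : (l1norm x == 0) = (x == 0).
Proof.
rewrite /l1norm psumr_eq0 //; apply/allP/eqP => [x0|-> i _].
  apply/colP => i; rewrite mxE; apply/eqP.
  by rewrite -normr_eq0; exact: x0 (mem_index_enum i).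
by rewrite mxE normr0 eqxx.
Qed.

Lemma l1normZ (R : realType) n (c : R) (x : 'cV[R]_n) :
  l1norm (c *: x) = `|c| * l1norm x.
Proof.
by rewrite mulr_sumr; apply: eq_bigr => i _; rewrite mxE normrM.
Qed.

(** The shift [b] lets one statement cover the objective, the unit sphere and the orthogonality
    constraints of the minimisation below. *)
Lemma continuous_l1norm_affine (R : realType) m n (M : 'M[R]_(m, n))
    (b : 'cV[R]_m) : continuous (fun y : 'rV[R]_n => l1norm (M *m y^T + b)).
Proof.
apply: continuous_big => [|i _]; first exact: add_continuous.
move=> y; apply: (continuous_comp _ (@norm_continuous _ _ _)).
rewrite (_ : (fun _ => _) = fun y : 'rV[R]_n => \sum_j M i j * y 0 j + b i 0).
  apply: continuousD; last exact: cst_continuous.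
  apply: continuous_big => [|j _ z]; first exact: add_continuous.
  apply: continuousM; first exact: cst_continuous.
  exact: coord_continuous.
by apply/funext => z; rewrite !mxE; under eq_bigr do rewrite mxE.
Qed.

(** The quotient and orthogonality to a kernel are invariant under scaling, so the numerator is
    minimised over [K], the part of the unit l1 sphere orthogonal to [Y], which is compact. *)
Lemma l1_quotient_min_exists (R : realType) m n (M : 'M[R]_(m, n))
    (Y := fun y : 'cV[R]_n => M *m y = 0) :
  (exists2 x, x != 0 & l1_orthogonal x Y) ->
  exists2 x, x != 0 /\ l1_orthogonal x Y &
    forall z, z != 0 -> l1_orthogonal z Y ->
      l1norm (M *m x) / l1norm x <= l1norm (M *m z) / l1norm z.
Proof.
pose K : set 'rV[R]_n := fun y => l1norm y^T = 1 /\ l1_orthogonal y^T Y.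
have normalize (x : 'cV[R]_n) : x != 0 -> l1_orthogonal x Y ->
    K ((l1norm x)^-1 *: x)^T.
  move=> x0 xY; have x_gt0 : 0 < l1norm x.
    by rewrite lt_neqAle l1norm_ge0 eq_sym l1norm_eq0 x0.
  have xV_gt0 : 0 < (l1norm x)^-1 by rewrite invr_gt0.
  split; rewrite trmxK ?l1normZ; first by rewrite gtr0_norm // mulVf ?gt_eqF.
  move=> y Yy; rewrite -[y](scalerK (lt0r_neq0 x_gt0)) -scalerDr !l1normZ.
  rewrite ler_wpM2l //; apply: xY.
  by rewrite /Y -scalemxAr Yy scaler0.
have cont k (A : 'M[R]_(k, n)) b := @continuous_l1norm_affine R k n A b.
have closedK : closed K.
  (* Each kernel vector [z] contributes one closed condition, and any intersection of closed sets is
     closed. *)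
  rewrite (_ : K =
       (fun y : 'rV[R]_n => l1norm (1%:M *m y^T + 0)) @^-1` [set 1%R]
     `&` \bigcap_(z in Y)
       (fun y : 'rV[R]_n => l1norm (1%:M *m y^T + z) - l1norm (1%:M *m y^T + 0))
         @^-1` [set r | 0 <= r])%classic; last first.
    apply/seteqP; split=> y [].
      move=> y1 yY; split; rewrite /= ?mul1mx ?addr0 // => z Yz /=.
      by rewrite !mul1mx addr0 subr_ge0; apply: yY.
    rewrite /= mul1mx addr0 => y1 yY; split=> // z /yY /=.
    by rewrite !mul1mx addr0 subr_ge0.
  apply: closedI.
    by apply: preimage_closed; [move=> y _; exact: cont|exact: closed_eq].
  apply: closed_bigI => z _; apply: preimage_closed; last exact: closed_ge.
  move=> y _; exact: (continuousB (cont _ _ z y) (cont _ _ 0 y)).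
(* A coordinate is at most the l1 norm in absolute value, so [K] lies in a cube. *)
have compactK : compact K.
  apply: subclosed_compact closedK
    (@rV_compact R n (fun=> `[-1, 1]%classic) (fun=> @segment_compact _ _ _)) _.
  move=> y [y1 _] i /=; rewrite in_itv /= -ler_norml -y1 /l1norm (bigD1 i) //=.
  by rewrite mxE lerDl sumr_ge0.
case=> x0 x0_neq0 x0Y.
have K0 : (K !=set0)%classic.
  by exists ((l1norm x0)^-1 *: x0)^T; exact: normalize.
have [|y /set_mem[y1 yY] ymin] := compact_EVT_min
  (f := fun y : 'rV[R]_n => l1norm (M *m y^T + 0)) K0 compactK.
  by apply: continuous_subspaceT => y; exact: cont.
exists y^T; first by split=> //; rewrite -l1norm_eq0 y1 oner_eq0.
move=> z z0 zY; rewrite y1 divr1 -[M *m y^T]addr0.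
apply: le_trans (ymin _ (mem_set (normalize z z0 zY))) _.
rewrite trmxK addr0 -scalemxAr l1normZ mulrC ger0_norm //.
by rewrite invr_ge0 l1norm_ge0.
Qed.

(** * Discrete coarea bound *)

(** Ordered pairs are summed: for symmetric [W] every pair counts twice, hence the factors 2 in the
    comparisons below. *)
Definition cut_weight (R : realType) (I : finType) (W : I -> I -> R)
    (x : I -> R) : R :=
  \sum_u \sum_v W u v * `|x u - x v|.

(** Induction on the size of the support: removing the layer of height the least positive value
    splits both sides additively and leaves a smaller support. *)
Lemma cut_weight_lower_bound_ge0 (R : realType) (I : finType) (V : {set I})
    (W : I -> I -> R) (phi : R) (n : nat) :
  (forall A : {set I}, A != finset.set0 -> A \subset V -> (2 * #|A| <= n)%N ->
     phi * #|A|%:R <= cut_weight W (fun i => (i \in A)%:R)) ->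
  forall x : I -> R, (forall i, 0 <= x i) ->
    [set i | x i != 0] \subset V -> (2 * #|[set i | x i != 0%R]| <= n)%N ->
    phi * \sum_i x i <= cut_weight W x.
Proof.
move=> cutW x; have [k] := ubnP #|[set i | x i != 0%R]|.
elim: k x => // k IHk x; set S := [set i | x i != 0].
move=> ltSk x_ge0 SV leSn; have [S0|[i0 i0S]] := set_0Vmem S.
  have x0 i : x i = 0.
    by apply/eqP; have := finset.in_set0 i; rewrite -S0 inE => /negbFE.
  rewrite /cut_weight !big1 ?mulr0 // => i _.
  by rewrite big1 // => j _; rewrite !x0 subrr normr0 mulr0.
case: (Order.TotalTheory.arg_minP x i0S) => i.
rewrite -[X in is_true X -> _]/(i \in S) => iS min_i.
pose y j := x j - x i * (j \in S)%:R.
have xE j : x j = y j + x i * (j \in S)%:R by rewrite /y subrK.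
have outS j : j \notin S -> x j = 0 by rewrite inE negbK => /eqP.
have y_ge0 j : 0 <= y j.
  rewrite /y; have [jS|/outS ->] := boolP (j \in S).
    by rewrite mulr1 subr_ge0 min_i.
  by rewrite mulr0 subr0.
have suppy : [set j | y j != 0] \subset S :\ i.
  apply/fintype.subsetP => j; rewrite in_setD1 finset.in_set /y.
  have [->|_] := eqVneq j i; first by rewrite iS mulr1 subrr eqxx.
  by case: (boolP (j \in S)) => [//|/outS ->]; rewrite mulr0 subr0 eqxx.
have card_suppy : (#|[set j | y j != 0%R]| < #|S|)%N.
  by rewrite (leq_ltn_trans (subset_leq_card suppy)) // [ltnRHS](cardsD1 i) iS.
have IHy : phi * \sum_j y j <= cut_weight W y.
  apply: IHk => //; first exact: leq_trans card_suppy ltSk.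
    rewrite (fintype.subset_trans suppy) //.
    by rewrite (fintype.subset_trans _ SV) ?subD1set.
  by apply: leq_trans leSn; rewrite leq_mul2l /= ltnW.
have yS j : j \notin S -> y j = 0.
  by move=> jS; rewrite /y outS // (negbTE jS) mulr0 subr0.
clearbody y.
have {}cutW : phi * #|S|%:R <= cut_weight W (fun j => (j \in S)%:R).
  by apply: cutW => //; apply/set0Pn; exists i.
(* Since [y] is nonnegative and vanishes off [S], the differences of [y] and of the layer never have
   opposite signs, so their absolute values add up. *)
have -> : cut_weight W x =
    cut_weight W y + x i * cut_weight W (fun j => (j \in S)%:R).
  rewrite /cut_weight mulr_sumr -big_split; apply: eq_bigr => u _ /=.
  rewrite mulr_sumr -big_split; apply: eq_bigr => v _ /=.
  rewrite mulrCA -mulrDr; congr (_ * _); rewrite (xE u) (xE v).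
  case: (boolP (u \in S)) => uS; case: (boolP (v \in S)) => vS.
  - by rewrite !subrr normr0 mulr0 addr0 opprD addrACA subrr addr0.
  - rewrite (yS v) // !mulr0 !addr0 !subr0 normr1 !mulr1.
    by rewrite !ger0_norm ?addr_ge0.
  - rewrite (yS u) // mulr0 add0r !sub0r !normrN normr1 !mulr1.
    by rewrite !ger0_norm ?addr_ge0.
  - by rewrite !yS // !mulr0 !addr0 subrr normr0 mulr0 addr0.
have -> : \sum_j x j = \sum_j y j + x i * #|S|%:R.
  under eq_bigr do rewrite xE.
  rewrite big_split /= -mulr_sumr; congr (_ + _ * _).
  rewrite -sum1_card natr_sum [RHS]big_mkcond.
  by apply: eq_bigr => j _; case: ifP.
by rewrite mulrDr lerD // mulrCA ler_wpM2l.
Qed.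

(** Both [|x u|] and [|x u - x v|] are additive over the positive part [p] and the negative part
    [q], whose supports are the two sets assumed small. *)
Lemma cut_weight_lower_bound (R : realType) (I : finType) (V : {set I})
    (W : I -> I -> R) (phi : R) (n : nat) :
  (forall A : {set I}, A != finset.set0 -> A \subset V -> (2 * #|A| <= n)%N ->
     phi * #|A|%:R <= cut_weight W (fun i => (i \in A)%:R)) ->
  forall x : I -> R, (forall i, i \notin V -> x i = 0) ->
    (2 * #|[set i in V | (0 < x i)%R]| <= n)%N ->
    (2 * #|[set i in V | (x i < 0)%R]| <= n)%N ->
    phi * \sum_i `|x i| <= cut_weight W x.
Proof.
move=> cutW x suppx pos_le neg_le.
pose p i := Num.max 0 (x i); pose q i := Num.max 0 (- x i).
have max_neq0 (a : R) : (Num.max 0 a != 0) = (0 < a).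
  by case: (ltP 0 a) => [/gt_eqF ->|]; rewrite ?eqxx.
have pE : [set i | p i != 0] = [set i in V | 0 < x i].
  apply/setP => i; rewrite !inE max_neq0.
  by case: (boolP (i \in V)) => // /suppx ->; rewrite ltxx.
have qE : [set i | q i != 0] = [set i in V | x i < 0].
  apply/setP => i; rewrite !inE max_neq0 oppr_gt0.
  by case: (boolP (i \in V)) => // /suppx ->; rewrite ltxx.
have subV (P : pred I) : [set i in V | P i] \subset V.
  by apply/fintype.subsetP => i; rewrite inE => /andP[].
have bp : phi * \sum_i p i <= cut_weight W p.
  apply: cut_weight_lower_bound_ge0 cutW _ _ _ _; rewrite ?pE // => i.
  by rewrite le_max lexx.
have bq : phi * \sum_i q i <= cut_weight W q.
  apply: cut_weight_lower_bound_ge0 cutW _ _ _ _; rewrite ?qE // => i.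
  by rewrite le_max lexx.
have max0N (a : R) : Num.max 0 (- a) = Num.max 0 a - a.
  by case: (lerP 0 a) => ?; case: (lerP 0 (- a)) => ?; lra.
have -> : \sum_i `|x i| = \sum_i p i + \sum_i q i.
  rewrite -big_split; apply: eq_bigr => i _ /=; rewrite /p /q.
  by rewrite max0N; case: (ger0P (x i)) => ?; lra.
have -> : cut_weight W x = cut_weight W p + cut_weight W q.
  rewrite /cut_weight -big_split; apply: eq_bigr => u _ /=.
  rewrite -big_split; apply: eq_bigr => v _ /=; rewrite -mulrDr; congr (_ * _).
  rewrite /p /q !max0N; case: (lerP 0 (x u)) => ?; case: (lerP 0 (x v)) => ?;
  do 3?match goal with |- context [ `|?e| ] => case: (ger0P e) => ? end; lra.
by rewrite mulrDr lerD.
Qed.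

(** * Means and medians *)

Definition mean (R : realType) (T : finType) (S : {set T}) (x : T -> R) : R :=
  (\sum_(v in S) x v) / #|S|%:R.

Section Mean.
Variables (R : realType) (T : finType) (S : {set T}) (x : T -> R).
Let m := mean S x.

Lemma sum_sub_mean : \sum_(v in S) (x v - m) = 0.
Proof.
have [S0|/set0Pn S0] := eqVneq S finset.set0; first by rewrite S0 big_set0.
rewrite sumrB sumr_const -mulr_natr /m /mean divfK ?subrr //.
by rewrite pnatr_eq0 -lt0n card_gt0; apply/set0Pn.
Qed.

(** Triangle inequality through [m]: a star dominates the clique on its leaves with weights
    [1 / #|S|]. *)
Lemma sum_pair_dist_le :
  (\sum_(u in S) \sum_(v in S) `|x u - x v|) / #|S|%:R
    <= 2 * \sum_(v in S) `|m - x v|.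
Proof.
have [S0|S0] := posnP #|S|.
  by rewrite S0 invr0 mulr0 mulr_ge0 ?sumr_ge0.
rewrite ler_pdivrMr ?ltr0n //.
apply: le_trans
  (_ : \sum_(u in S) \sum_(v in S) (`|m - x u| + `|m - x v|) <= _).
  apply: ler_sum => u _; apply: ler_sum => v _.
  by rewrite (distrC m (x u)) ler_distD.
under eq_bigr do rewrite big_split /= sumr_const -mulr_natr.
by rewrite big_split /= -mulr_suml sumr_const -mulr_natr; lra.
Qed.

(** Star-mesh identity: for squares there is equality, because the cross terms vanish when
    deviations from the mean are summed. *)
Lemma sum_pair_sqr_dist :
  (\sum_(u in S) \sum_(v in S) (x u - x v) ^+ 2) / #|S|%:R
    = 2 * \sum_(v in S) (m - x v) ^+ 2.
Proof.
have [S0|S0] := posnP #|S|.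
  by rewrite (cards0_eq S0) !big_set0 mul0r mulr0.
apply: (@mulIf _ #|S|%:R); first by rewrite pnatr_eq0 -lt0n.
rewrite divfK ?pnatr_eq0 -?lt0n //.
transitivity (\sum_(u in S) \sum_(v in S)
  ((m - x u) ^+ 2 + (m - x v) ^+ 2 - 2 * (x u - m) * (x v - m))).
  by apply: eq_bigr => u _; apply: eq_bigr => v _; ring.
under eq_bigr do rewrite sumrB big_split /= sumr_const
  -[_ *+ #|S|]mulr_natr -mulr_sumr sum_sub_mean mulr0 subr0.
by rewrite big_split /= -mulr_suml sumr_const -[_ *+ #|S|]mulr_natr; ring.
Qed.

Lemma sum_dist_mean_indicator : (forall v, x v = 0 \/ x v = 1) ->
  \sum_(v in S) `|m - x v| = 2 * \sum_(v in S) (m - x v) ^+ 2.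
Proof.
move=> x01; have [S0|S0] := posnP #|S|.
  by rewrite (cards0_eq S0) !big_set0 mulr0.
have x_ge0 v : 0 <= x v <= 1 by case: (x01 v) => ->; rewrite ?lexx ?ler01.
have m_ge0 : 0 <= m.
  by rewrite divr_ge0 ?ler0n ?sumr_ge0 // => v _; case/andP: (x_ge0 v).
have m_le1 : m <= 1.
  rewrite ler_pdivrMr ?ltr0n // mul1r -sum1_card natr_sum ler_sum // => v _.
  by case/andP: (x_ge0 v).
(* For x in {0, 1} and 0 <= m <= 1,
   2 (m - x)^2 - |m - x| = (1 - 2 m) (x - m). *)
apply/eqP; rewrite -subr_eq0 mulr_sumr -sumrB; apply/eqP.
transitivity ((2 * m - 1) * \sum_(v in S) (x v - m)).
  rewrite mulr_sumr; apply: eq_bigr => v _.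
  case: (x01 v) => ->; first by rewrite subr0 ger0_norm //; ring.
  by rewrite ler0_norm ?subr_le0 //; ring.
by rewrite sum_sub_mean mulr0.
Qed.

End Mean.

Lemma sum_indicator (R : realType) (T : finType) (A V : {set T}) :
  A \subset V -> \sum_(v in V) (v \in A)%:R = #|A|%:R :> R.
Proof.
move=> AV; rewrite -[in RHS](finset.setIidPr AV) -sum1_card natr_sum.
rewrite big_mkcond [RHS]big_mkcond; apply: eq_bigr => v _; rewrite inE.
by case: (v \in V); case: (v \in A).
Qed.

(** Take [c = - x i] with [x i] the least positive value: entries in [S] lose [x i] in absolute
    value and the others gain [x i], so [S] cannot be a majority. *)
Lemma card_pos_le_half (R : realType) (T : finType) (V : {set T}) (x : T -> R) :
  (forall c, \sum_(v in V) `|x v| <= \sum_(v in V) `|x v + c|) ->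
  (2 * #|[set v in V | (0 < x v)%R]| <= #|V|)%N.
Proof.
move=> xV; set S := [set v in V | _]; have [->|[i0 i0S]] := set_0Vmem S.
  by rewrite cards0 muln0.
case: (Order.TotalTheory.arg_minP x i0S) => i.
rewrite -[X in is_true X -> _]/(i \in S) => iS min_i.
have xi : 0 < x i by move: iS; rewrite inE => /andP[].
have := xV (- x i); rewrite -subr_ge0 -sumrB => /le_trans sum_ge0.
have {sum_ge0} : 0 <= \sum_(v in V) (x i - 2 * x i * (v \in S)%:R).
  apply: sum_ge0; apply: ler_sum => v vV.
  have [vS|] := boolP (v \in S); last first.
    rewrite inE vV -leNgt /= => xv; rewrite mulr0 subr0.
    by rewrite !ler0_norm //; lra.
  have xv : x i <= x v by exact: min_i.
  by rewrite mulr1 !ger0_norm; lra.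
have SV : S \subset V by apply/fintype.subsetP => v; rewrite inE => /andP[].
rewrite sumrB sumr_const -mulr_sumr (sum_indicator _ SV) -[_ *+ #|V|]mulr_natr.
by rewrite (mulrC 2) -mulrA -mulrBr pmulr_rge0 // subr_ge0 -natrM ler_nat.
Qed.

(** Termwise, the shift gains at least [|c|] off [A] and loses at most [|c|] on [A]. *)
Lemma l1_indicator_orthogonal_const (R : realType) (T : finType) (A V : {set T})
    (c : R) : A \subset V -> (2 * #|A| <= #|V|)%N ->
  \sum_(v in V) `|(v \in A)%:R| <= \sum_(v in V) `|(v \in A)%:R + c|.
Proof.
move=> AV leAV; rewrite -subr_ge0 -sumrB.
apply: le_trans (_ : 0 <= \sum_(v in V) (`|c| - 2 * `|c| * (v \in A)%:R)) _.
  rewrite sumrB sumr_const -mulr_sumr (sum_indicator _ AV).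
  rewrite -[_ *+ #|V|]mulr_natr.
  by rewrite (mulrC 2) -mulrA -mulrBr mulr_ge0 // subr_ge0 -natrM ler_nat.
apply: ler_sum => v _; case: (v \in A); rewrite ?normr0 ?add0r ?mulr0 ?mulr1 //.
have := ler_normB (1 + c) c; rewrite addrK normr1; lra.
Qed.

(** * The projected gradient *)

Lemma trmx_mul_self_eq0 (R : realType) n (d : 'cV[R]_n) :
  (d^T *m d) 0 0 = 0 -> d = 0.
Proof.
rewrite mxE; under eq_bigr do rewrite mxE -expr2.
move=> /eqP; rewrite psumr_eq0 => [/allP d0|i _]; last exact: sqr_ge0.
apply/colP => i; rewrite [RHS]mxE; apply/eqP; rewrite -sqrf_eq0.
exact: d0 (mem_index_enum i).
Qed.

(** The image of [D^T] is orthogonal to [ker D], so the difference of the two candidates lies in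
    [ker D] and is orthogonal to it. *)
Lemma proj_ker_eq (R : realType) p n (D : 'M[R]_(p, n)) (c q : 'cV[R]_n)
    (z : 'cV[R]_p) : D *m q = 0 -> q = c + D^T *m z -> proj_ker D *m c = q.
Proof.
move=> Dq qE; have [DPc orth] := proj_kerP D c.
apply/eqP; rewrite -subr_eq0; apply/eqP.
set d := _ - q; have Dd : D *m d = 0 by rewrite mulmxBr DPc Dq subrr.
apply: trmx_mul_self_eq0.
have dE : d^T = - (c - proj_ker D *m c)^T - z^T *m D.
  rewrite -[in z^T *m D](trmxK D) -trmx_mul -raddfN -raddfB; congr _^T.
  by rewrite /d qE opprB opprD addrA.
by rewrite {1}dE mulmxBl mulNmx orth // -mulmxA Dd mulmx0 oppr0 addr0 mxE.
Qed.

Section Extension.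
Variables (R : realType) (T : finType) (A : {set T}).

(** Extension by zero, written as a sum over the enumeration to match products with transposed
    incidence matrices. *)
Definition ext (x : 'cV[R]_#|A|) (v : T) : R :=
  \sum_i (v == enum_val i)%:R * x i 0.

Lemma ext_enum_val x i : ext x (enum_val i) = x i 0.
Proof.
rewrite /ext (bigD1 i) //= eqxx mul1r big1 ?addr0 // => j ji.
by rewrite (inj_eq enum_val_inj) eq_sym (negbTE ji) mul0r.
Qed.

Lemma ext_out x v : v \notin A -> ext x v = 0.
Proof.
move=> vA; rewrite /ext big1 // => i _.
have [vi|_] := eqVneq; rewrite ?mul0r //.
by rewrite vi enum_valP in vA.
Qed.

Lemma ext_eq (x : 'cV[R]_#|A|) (f : T -> R) v :
  (forall i, x i 0 = f (enum_val i)) -> v \in A -> ext x v = f v.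
Proof.
by move=> xf vA; rewrite -(enum_rankK_in vA vA) ext_enum_val.
Qed.

Lemma sum_ext (g : R -> R) x : \sum_(v in A) g (ext x v) = \sum_i g (x i 0).
Proof. by rewrite big_enum_val; under eq_bigr do rewrite ext_enum_val. Qed.

Lemma sum_ext_total (g : R -> R) x : g 0 = 0 ->
  \sum_v g (ext x v) = \sum_(v in A) g (ext x v).
Proof.
move=> g0; rewrite [RHS]big_mkcond; apply: eq_bigr => v _.
by case: ifP => // /negbT/ext_out ->.
Qed.

End Extension.

Section Gradient.
Variables (R : realType) (T : finType) (E : {set T * T}).

Definition grad (f : T -> R) : 'cV[R]_#|E| :=
  \col_j (f (enum_val j).2 - f (enum_val j).1).

(** With [A] either [VH] or its complement, this covers both [Bmx] and [Dmx]. *)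
Lemma tr_incidence_mul (A : {set T}) (x : 'cV[R]_#|A|) :
  (\matrix_(i < #|A|, j < #|E|) incidence R (enum_val i) (enum_val j))^T *m x
    = grad (ext x).
Proof.
apply/colP => j; rewrite !mxE /ext -sumrB; apply: eq_bigr => i _.
by rewrite !mxE /incidence mulrBl !(eq_sym (enum_val i)).
Qed.

Lemma sum_grad (g : R -> R) (f : T -> R) :
  \sum_j g (grad f j 0) = \sum_(e in E) g (f e.2 - f e.1).
Proof. by rewrite [RHS]big_enum_val; apply: eq_bigr => j _; rewrite mxE. Qed.

End Gradient.

Section Kron.
Variables (R : realType) (T : finType) (G : sgraph T) (VH : {set T}).
Variable E : {set T * T}.
Hypothesis hE : orientation G E.
Hypothesis hind : independent G (~: VH).

Definition nbhd (w : T) : {set T} := [set v | G w v].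

(** Independence enters here: all neighbours of an outside vertex carry prescribed values, which
    makes the extension by means explicit. *)
Lemma nbhd_compl w v : w \notin VH -> v \in nbhd w -> v \in VH.
Proof.
move=> wV; rewrite inE => wv; apply: contraLR wv => vV.
by apply: hind; rewrite inE.
Qed.

Lemma sum_oriented (F : T -> T -> R) : (forall u v, F u v = F v u) ->
  \sum_u \sum_(v in nbhd u) F u v = 2 * \sum_(e in E) F e.1 e.2.
Proof.
move=> Fsym; case: hE => EG GE.
(* An adjacent ordered pair is an oriented edge in exactly one of its two directions. *)
have GR p : (G p.1 p.2)%:R = (p \in E)%:R + ((p.2, p.1) \in E)%:R :> R.
  case: p => u v /=; have := GE u v; have := @EG u v; have := @EG v u.
  rewrite (adj_sym G v u).
  case: ((u, v) \in E); case: ((v, u) \in E); case: (G u v) => //= a b c;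
    rewrite ?addr0 ?add0r //; by [have := a isT|have := b isT|have := c isT].
rewrite pair_big_dep /= big_mkcond /=.
transitivity (\sum_(p : T * T) ((p \in E)%:R * F p.1 p.2)
            + \sum_(p : T * T) (((p.2, p.1) \in E)%:R * F p.1 p.2)).
  rewrite -big_split; apply: eq_bigr => p _ /=.
  by rewrite inE -mulrDl -GR; case: ifP; rewrite ?mul1r ?mul0r.
rewrite [X in _ + X](reindex_inj (h := fun p => (p.2, p.1))) /=; last first.
  by move=> [a b] [c d] [-> ->].
have -> : \sum_(j : T * T) ((j.1, j.2) \in E)%:R * F j.2 j.1
        = \sum_(p : T * T) ((p \in E)%:R * F p.1 p.2).
  by apply: eq_bigr => -[a b] _ /=; rewrite Fsym.
rewrite -mulr2n -[LHS]mulr_natl; congr (_ * _).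
rewrite [RHS]big_mkcond; apply: eq_bigr => p _.
by case: ifP; rewrite ?mul1r ?mul0r.
Qed.

(* Extension of x that makes the net flow of its gradient vanish at every
   vertex outside VH. *)
Definition harm (x : 'cV[R]_#|VH|) (v : T) : R :=
  if v \in VH then ext x v else mean (nbhd v) (ext x).

Lemma Dmx_grad_harm x : Dmx R VH E *m grad E (harm x) = 0.
Proof.
apply/colP => i; rewrite [RHS]mxE mxE; set f := harm x; set w := enum_val i.
have wV : w \notin VH by have := enum_valP i; rewrite inE.
(* Both factors change sign when an edge is reversed, so the net flow at [w] does not depend on the
   orientation. *)
pose F u v := ((w == v)%:R - (w == u)%:R) * (f v - f u).
apply: (@mulfI _ 2); first by rewrite pnatr_eq0.
transitivity (2 * \sum_(e in E) F e.1 e.2).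
  congr (_ * _); rewrite [RHS]big_enum_val; apply: eq_bigr => j _.
  by rewrite !mxE.
rewrite -sum_oriented; last by move=> u v; rewrite /F; ring.
pose S := \sum_(v in nbhd w) (f v - f w).
have S0 : S = 0.
  rewrite -[RHS](sum_sub_mean (nbhd w) (ext x)); apply: eq_bigr => v vw.
  by rewrite /f /harm (negbTE wV) (nbhd_compl wV vw).
transitivity (\sum_u \sum_(v in nbhd u) (w == v)%:R * (f v - f u)
            - \sum_u \sum_(v in nbhd u) (w == u)%:R * (f v - f u)).
  rewrite -sumrB; apply: eq_bigr => u _; rewrite -sumrB; apply: eq_bigr => v _.
  by rewrite /F mulrBl.
have -> : \sum_u \sum_(v in nbhd u) (w == u)%:R * (f v - f u) = S.
  rewrite (bigD1 w) //= [X in _ + X]big1 ?addr0 => [|u uw].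
    by apply: eq_bigr => v _; rewrite eqxx mul1r.
  by rewrite big1 // => v _; rewrite eq_sym (negbTE uw) mul0r.
have -> : \sum_u \sum_(v in nbhd u) (w == v)%:R * (f v - f u) = - S.
  rewrite /S -sumrN [RHS]big_mkcond; apply: eq_bigr => u _.
  rewrite big_mkcond (bigD1 w) //= [X in _ + X]big1 => [|v vw].
    by rewrite !inE adj_sym eqxx mul1r opprB addr0.
  by rewrite eq_sym (negbTE vw) mul0r if_same.
by rewrite S0 subr0 oppr0 mulr0.
Qed.

Lemma PBT_mul x : Pmx R VH E *m (Bmx R VH E)^T *m x = grad E (harm x).
Proof.
rewrite -mulmxA /Bmx tr_incidence_mul /Pmx.
(* The means at the outside vertices are the coefficients of the rows of [D] that correct
   [B^T x]. *)
pose z : 'cV[R]_#|~: VH| := \col_i mean (nbhd (enum_val i)) (ext x).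
apply: (proj_ker_eq (z := z)); first exact: Dmx_grad_harm.
rewrite /Dmx tr_incidence_mul; apply/colP => j.
suff harmE v : harm x v = ext x v + ext z v by rewrite !mxE !harmE; ring.
rewrite /harm; case: ifPn => vV; first by rewrite (ext_out z) ?addr0 // inE vV.
rewrite (ext_out x) // add0r (ext_eq (f := fun w => mean (nbhd w) (ext x))) //.
  by move=> i; rewrite mxE.
by rewrite inE.
Qed.

Lemma l1norm_PBT x : 2 * l1norm (Pmx R VH E *m (Bmx R VH E)^T *m x)
  = \sum_u \sum_(v in nbhd u) `|harm x u - harm x v|.
Proof.
rewrite PBT_mul /l1norm sum_grad sum_oriented => [|u v]; last exact: distrC.
by congr (_ * _); apply: eq_bigr => e _; rewrite distrC.
Qed.

Lemma persistent_laplacian_quad x :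
  2 * (x^T *m persistent_laplacian R VH E *m x) 0 0
    = \sum_u \sum_(v in nbhd u) (harm x u - harm x v) ^+ 2.
Proof.
set B := Bmx R VH E; set P := Pmx R VH E.
have quadE : x^T *m persistent_laplacian R VH E *m x
    = (P *m B^T *m x)^T *m (P *m B^T *m x).
  rewrite /persistent_laplacian -/B -/P.
  (* The residual of the projection of [B^T x] is orthogonal to the projection itself, so the
     quadratic form is the squared norm of [P B^T x]. *)
  have [DPc orth] := proj_kerP (Dmx R VH E) (B^T *m x).
  have /eqP := orth _ DPc; rewrite -[proj_ker _]/P linearB /= mulmxBl subr_eq0.
  by rewrite -!mulmxA => /eqP <-; rewrite trmx_mul trmxK !mulmxA.
rewrite quadE PBT_mul mxE; under eq_bigr do rewrite mxE -expr2.
rewrite (sum_grad _ (fun r => r ^+ 2)) sum_oriented => [|u v]; last by ring.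
by congr (_ * _); apply: eq_bigr => e _; ring.
Qed.

(** * Comparison with the Kron-reduced cut weight *)

(** No edge joins two outside vertices; an edge with one outside end occurs in both orders, hence
    the 2. *)
Lemma sum_split_compl (F : T -> T -> R) : (forall u v, F u v = F v u) ->
  \sum_u \sum_(v in nbhd u) F u v =
    \sum_(u in VH) \sum_(v in VH | v \in nbhd u) F u v
    + 2 * \sum_(w | w \notin VH) \sum_(v in nbhd w) F w v.
Proof.
move=> Fsym; rewrite (bigID (mem VH)) /= mulr_natl mulr2n addrA.
congr (_ + _).
under eq_bigr => u uV.
  rewrite (bigID (mem VH)) /=.
  under eq_bigl do rewrite andbC.
  over.
rewrite big_split /=; congr (_ + _).
rewrite (exchange_big_dep (fun w => w \notin VH)) /=; last first.
  by move=> u v _ /andP[].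
apply: eq_bigr => w wV; apply: eq_big => [u|u _]; last by rewrite Fsym.
apply/andP/idP => [[_ /andP[]]|wu]; first by rewrite !inE adj_sym.
split; first exact: nbhd_compl wu.
by rewrite wV andbT; move: wu; rewrite !inE adj_sym.
Qed.

(* Weights of the Kron reduction of G onto VH. *)
Definition kron_weight (u v : T) : R :=
  [&& u \in VH, v \in VH & v \in nbhd u]%:R
  + \sum_(w | w \notin VH) ((u \in nbhd w) && (v \in nbhd w))%:R / #|nbhd w|%:R.

(** Same shape as [sum_split_compl], with the star at each outside vertex replaced by a clique, so
    the two sums can be compared star by star. *)
Lemma sum_kron_weight (F : T -> T -> R) :
  \sum_u \sum_v kron_weight u v * F u v =
    \sum_(u in VH) \sum_(v in VH | v \in nbhd u) F u v
    + \sum_(w | w \notin VH)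
        (\sum_(u in nbhd w) \sum_(v in nbhd w) F u v) / #|nbhd w|%:R.
Proof.
transitivity (\sum_u \sum_v [&& u \in VH, v \in VH & v \in nbhd u]%:R * F u v
  + \sum_u \sum_v \sum_(w | w \notin VH)
      ((u \in nbhd w) && (v \in nbhd w))%:R / #|nbhd w|%:R * F u v).
  rewrite -big_split; apply: eq_bigr => u _ /=.
  rewrite -big_split; apply: eq_bigr => v _ /=.
  by rewrite -mulr_suml -mulrDl.
congr (_ + _).
  rewrite [RHS]big_mkcond; apply: eq_bigr => u _; case: (u \in VH) => /=.
    rewrite [RHS]big_mkcond; apply: eq_bigr => v _.
    by case: ifP; rewrite ?mul1r ?mul0r.
  by rewrite big1 // => v _; rewrite mul0r.
under eq_bigr do rewrite exchange_big /=.
rewrite exchange_big /=; apply: eq_bigr => w _.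
rewrite mulr_suml [RHS]big_mkcond; apply: eq_bigr => u _.
case: (u \in nbhd w) => /=; last by rewrite big1 // => v _; rewrite !mul0r.
rewrite mulr_suml [RHS]big_mkcond; apply: eq_bigr => v _.
by case: ifP; rewrite ?mul0r // mul1r mulrC.
Qed.

Lemma cut_weight_kron_le x :
  cut_weight kron_weight (ext x)
    <= 2 * l1norm (Pmx R VH E *m (Bmx R VH E)^T *m x).
Proof.
rewrite l1norm_PBT /cut_weight sum_kron_weight.
rewrite sum_split_compl => [|u v]; last exact: distrC.
apply: lerD.
  apply: ler_sum => u uV; apply: ler_sum => v /andP[vV _].
  by rewrite /harm uV vV.
rewrite mulr_sumr; apply: ler_sum => w wV.
apply: le_trans (sum_pair_dist_le _ _) _.
rewrite ler_pM2l // ler_sum // => v vw.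
by rewrite /harm (negbTE wV) (nbhd_compl wV vw).
Qed.

Section Indicator.
Variable x : 'cV[R]_#|VH|.
Hypothesis x01 : forall v, ext x v = 0 \/ ext x v = 1.

Let dist_sqr u v : `|ext x u - ext x v| = (ext x u - ext x v) ^+ 2.
Proof.
by case: (x01 u) (x01 v) => -> [] ->;
  rewrite ?subrr ?subr0 ?sub0r ?normrN ?normr0 ?normr1 ?sqrrN ?expr0n ?expr1n.
Qed.

(** On [VH] distances between 0 and 1 equal their squares, and for squares each clique matches its
    star exactly. *)
Lemma cut_weight_kron_indicator :
  cut_weight kron_weight (ext x)
    = 2 * (x^T *m persistent_laplacian R VH E *m x) 0 0.
Proof.
rewrite persistent_laplacian_quad /cut_weight sum_kron_weight.
rewrite sum_split_compl => [|u v]; last by ring.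
congr (_ + _).
  apply: eq_bigr => u uV; apply: eq_bigr => v /andP[vV _].
  by rewrite /harm uV vV.
rewrite mulr_sumr; apply: eq_bigr => w wV.
under eq_bigr do under eq_bigr do rewrite dist_sqr.
rewrite sum_pair_sqr_dist; congr (_ * _); apply: eq_bigr => v vw.
by rewrite /harm (negbTE wV) (nbhd_compl wV vw).
Qed.

(** The factor 2 comes from the stars, where it is exact; on edges inside [VH] distance and square
    agree. *)
Lemma l1norm_PBT_indicator_le :
  l1norm (Pmx R VH E *m (Bmx R VH E)^T *m x)
    <= 2 * (x^T *m persistent_laplacian R VH E *m x) 0 0.
Proof.
rewrite -(ler_pM2l (x := 2)) // mulrCA l1norm_PBT persistent_laplacian_quad.
rewrite sum_split_compl => [|u v]; last exact: distrC.
rewrite sum_split_compl => [|u v]; last by ring.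
rewrite mulrDr lerD //.
  rewrite mulr_sumr ler_sum // => u uV.
  rewrite mulr_sumr ler_sum // => v /andP[vV _].
  rewrite /harm uV vV dist_sqr.
  by have := sqr_ge0 (ext x u - ext x v); lra.
rewrite mulrCA ler_pM2l // mulr_sumr ler_sum // => w wV.
rewrite le_eqVlt; apply/orP; left; apply/eqP.
have harmE v : v \in nbhd w ->
    harm x w - harm x v = mean (nbhd w) (ext x) - ext x v.
  by move=> vw; rewrite /harm (negbTE wV) (nbhd_compl wV vw).
under eq_bigr => v vw do rewrite harmE //.
under [in RHS]eq_bigr => v vw do rewrite harmE //.
exact: sum_dist_mean_indicator.
Qed.

End Indicator.

(** * The kernel of [P B^T] and l1 orthogonality *)

Lemma PBT_const_mx c : ker_PBT E (const_mx c : 'cV[R]_#|VH|).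
Proof.
rewrite /ker_PBT PBT_mul; set y := const_mx c.
have extc v : v \in VH -> ext y v = c.
  by move=> vV; rewrite (ext_eq (f := fun=> c)) // => i; rewrite mxE.
(* Stated only for ends of edges: an isolated outside vertex gets the mean 0 of the empty set
   instead of [c]. *)
have harmc u v : v \in nbhd u -> harm y u = c.
  move=> uv; rewrite /harm; case: ifPn => [/extc //|uV].
  rewrite /mean (eq_bigr (fun=> c)) => [|w uw]; last first.
    exact: extc (nbhd_compl uV uw).
  rewrite sumr_const -[_ *+ _]mulr_natr mulfK // pnatr_eq0 -lt0n card_gt0.
  by apply/set0Pn; exists v.
apply/colP => j; rewrite !mxE; have := enum_valP j.
case: (enum_val j) => u v /=.
case: hE => EG _ /EG uv.
by rewrite (harmc u v) ?(harmc v u) ?subrr // inE // adj_sym.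
Qed.

(** A vanishing gradient makes [harm y] constant along paths of [G], which may leave [VH]. *)
Lemma ker_PBT_const (hconn : connected_graph G) (y : 'cV[R]_#|VH|) i j :
  ker_PBT E y -> y i 0 = y j 0.
Proof.
rewrite /ker_PBT PBT_mul => grad0; have [_ GE] := hE.
have edge e : e \in E -> harm y e.1 = harm y e.2.
  move=> eE; have /colP/(_ (enum_rank_in eE e)) := grad0.
  by rewrite !mxE enum_rankK_in // => /eqP; rewrite subr_eq0 => /eqP.
have adjE u v : G u v -> harm y u = harm y v.
  by move=> /GE; case: (boolP ((u, v) \in E)) => [/edge|_ /edge] //= ->.
have harmE k : y k 0 = harm y (enum_val k).
  by rewrite /harm enum_valP ext_enum_val.
rewrite !harmE; have /connectP[p] := hconn (enum_val i) (enum_val j).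
elim: p (enum_val i) => [u _ ->//|v p IHp u /= /andP[/adjE -> pp]].
exact: IHp.
Qed.

Lemma l1norm_chi (A : {set T}) : A \subset VH -> l1norm (chi R VH A) = #|A|%:R.
Proof.
move=> AV; rewrite -(sum_indicator R AV) [RHS]big_enum_val.
by apply: eq_bigr => i _; rewrite mxE normr_nat.
Qed.

Lemma ext_chi (A : {set T}) v : A \subset VH ->
  ext (chi R VH A) v = (v \in A)%:R.
Proof.
move=> /fintype.subsetP AV; have [vV|vV] := boolP (v \in VH).
  by rewrite (ext_eq (f := fun v => (v \in A)%:R)) // => i; rewrite mxE.
by rewrite ext_out //; case: (boolP (v \in A)) vV => // /AV ->.
Qed.

Lemma chi_l1_orthogonal (A : {set T}) : connected_graph G ->
  A \subset VH -> (2 * #|A| <= #|VH|)%N ->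
  l1_orthogonal (chi R VH A) (ker_PBT E).
Proof.
(* The common value is named as an average, which requires no chosen index even if [VH] is empty. *)
move=> hconn AV leAV y ky; pose c := \sum_i y i 0 / #|VH|%:R.
have yc i : y i 0 = c.
  rewrite /c (eq_bigr (fun=> y i 0 / #|VH|%:R)) => [|j _]; last first.
    by rewrite (ker_PBT_const hconn j i ky).
  rewrite sumr_const card_ord -[_ *+ _]mulr_natr divfK // pnatr_eq0 -lt0n.
  exact: leq_ltn_trans (ltn_ord i).
have := l1_indicator_orthogonal_const c AV leAV.
rewrite [X in X <= _]big_enum_val [X in _ <= X]big_enum_val /l1norm.
congr (_ <= _); apply: eq_bigr => i _.
  by rewrite mxE.
by rewrite !mxE yc.
Qed.

(** Orthogonality is tested on constants only; the negative side follows by applying the positive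
    one to [- x]. *)
Lemma card_median (x : 'cV[R]_#|VH|) : l1_orthogonal x (ker_PBT E) ->
  (2 * #|[set v in VH | (0 < ext x v)%R]| <= #|VH|)%N /\
  (2 * #|[set v in VH | (ext x v < 0)%R]| <= #|VH|)%N.
Proof.
move=> xY.
have le_shift c : \sum_(v in VH) `|ext x v| <= \sum_(v in VH) `|ext x v + c|.
  rewrite (sum_ext Num.norm) (sum_ext (fun r => `|r + c|)).
  have := xY _ (PBT_const_mx c); congr (_ <= _).
  by apply: eq_bigr => i _; rewrite !mxE.
split; first exact: card_pos_le_half le_shift.
have := @card_pos_le_half R T VH (fun v => - ext x v).
under eq_finset do rewrite oppr_gt0.
apply=> c; under eq_bigr do rewrite normrN.
apply: le_trans (le_shift (- c)) _; apply: ler_sum => v _.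
by rewrite -normrN opprB addrC.
Qed.

End Kron.

Theorem proposition7p4 (R : realType) (T : finType) (G : sgraph T)
    (H : subgraph G) (E : {set T * T})
    (hE : orientation G E)
    (hconn : connected_graph G)
    (hcard : (2 <= #|sub_verts H|)%N)
    (hind : independent G (~: sub_verts H))
    (hone : forall v, v \in sub_verts H ->
       #|[pred w | (w \in ~: sub_verts H) && G v w]| = 1%N) :
  exists phi_Kron phi_0 : R,
    [/\ is_phi_Kron (sub_verts H) E phi_Kron,
        is_phi_0 (sub_verts H) E phi_0,
        phi_Kron <= phi_0 &
        phi_0 <= 2 * phi_Kron].
Proof.
move: (sub_verts H) hcard hind {hone} => V hcard hind.
pose small (A : {set T}) :=
  [&& A != finset.set0, A \subset V & (2 * #|A| <= #|V|)%N].
pose Q (A : {set T}) :=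
  ((chi R V A)^T *m persistent_laplacian R V E *m chi R V A) 0 0 : R.
have smallP (A : {set T}) : small A <->
    [/\ A != finset.set0, A \subset V & #|A|%:R <= #|V|%:R / 2 :> R].
  rewrite ler_pdivlMr // -natrM ler_nat mulnC.
  by split=> [/and3P[]|[a b c]]; [split|apply/and3P; split].
have [v0 v0V] : exists v0, v0 \in V by apply/set0Pn; rewrite -card_gt0 ltnW.
(* A singleton is admissible because [V] has at least two elements; it shows that both minima range
   over nonempty sets. *)
have small0 : small [set v0].
  rewrite /small finset.sub1set v0V cards1 muln1 hcard !andbT.
  by apply/set0Pn; exists v0; rewrite inE.
have card_gt0R A : small A -> 0 < #|A|%:R :> R.
  by case/and3P=> A0 _ _; rewrite ltr0n card_gt0.
have chi_neq0 A : small A -> chi R V A != 0.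
  move=> sA; have /and3P[_ AV _] := sA.
  by rewrite -l1norm_eq0 l1norm_chi // gt_eqF // card_gt0R.
have chi_orth A : small A -> l1_orthogonal (chi R V A) (ker_PBT E).
  by case/and3P=> _ AV leA; exact (chi_l1_orthogonal hE hind hconn AV leA).
have chi01 (A : {set T}) : A \subset V ->
    forall v, ext (chi R V A) v = 0 \/ ext (chi R V A) v = 1.
  by move=> AV v; rewrite ext_chi //; case: (v \in A); [right|left].
case: (Order.TotalTheory.arg_minP (fun A => Q A / #|A|%:R) small0) => A sA minA.
have [|x [x0 xY] xmin] :=
    @l1_quotient_min_exists R _ _ (Pmx R V E *m (Bmx R V E)^T).
  by exists (chi R V [set v0]); [exact: chi_neq0|exact: chi_orth].
have x_gt0 : 0 < l1norm x by rewrite lt_neqAle l1norm_ge0 eq_sym l1norm_eq0 x0.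
exists (Q A / #|A|%:R), (l1norm (Pmx R V E *m (Bmx R V E)^T *m x) / l1norm x).
split.
- split; first by exists A; have /smallP[A0 AV leA] := sA; split.
  by move=> _ [B [B0 BV leB ->]]; apply: minA; apply/smallP; split.
- split; first by exists x; split.
  by move=> _ [z [z0 zY ->]]; apply: xmin.
(* Doubling matches the ordered-pair convention: the coarea bound is applied with constant twice the
   Kron minimum. *)
- rewrite ler_pdivlMr // -(ler_pM2l (x := 2)) // mulrA.
  apply: le_trans (cut_weight_kron_le hE hind x).
  have [pos_le neg_le] := card_median hE hind xY.
  rewrite /l1norm -(sum_ext Num.norm) -sum_ext_total ?normr0 //.
  apply: cut_weight_lower_bound pos_le neg_le => [B B0 BV leB|v vV]; last first.
    exact: ext_out.
  have sB : small B by apply/and3P; split.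
  have -> : cut_weight (kron_weight R G V) (fun i => (i \in B)%:R) = 2 * Q B.
    rewrite -(cut_weight_kron_indicator hE hind (chi01 B BV)); congr cut_weight.
    by apply/funext => v; rewrite ext_chi.
  by rewrite -mulrA ler_pM2l // -ler_pdivlMr ?card_gt0R // minA.
(* The indicator of the optimal set [A] is a competitor for the l1 minimum. *)
- apply: le_trans (xmin _ (chi_neq0 _ sA) (chi_orth _ sA)) _.
  have /and3P[_ AV _] := sA.
  rewrite l1norm_chi // mulrA ler_pM2r ?invr_gt0 ?card_gt0R //.
  exact (l1norm_PBT_indicator_le hE hind (chi01 A AV)).
Qed.
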